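(* Let $\delta\colon R(A,P_0)\to R(A,P_0)$ be a nontrivial primitive $K_0$-homogeneous locally nilpotent derivation. (i) If $\delta$ is of vertical type, then $\delta(T_{ij})=0$ for all $i,j$, and there is a $k_0$ such that $\delta(S_{k_0})$ does not depend on $S_{k_0}$ and $\delta(S_k)=0$ for all $k\ne k_0$. (ii) If $\delta$ is of horizontal type, then $\delta=h\,\delta_{C,\beta}$, where $\delta_{C,\beta}$ is one of the derivations defined in the context (for some admissible $C,\beta$) and $h$ is $K_0$-homogeneous with $h\in\ker(\delta_{C,\beta})$.
   Context: $\mathbb{K}$ is an algebraically closed field of characteristic zero. Ring $R(A,P_0)$: fix $r\ge1$, $n_0,\dots,n_r\ge1$, $n=n_0+\dots+n_r$, $m\ge0$. $A=[a_0,\dots,a_r]$ is a matrix with pairwise linearly independent columns $a_i\in\mathbb{K}^2$. $P_0=(L_0,0)$ is the integral $r\times(n+m)$ matrix, where $L_0$ is the $r\times n$ matrix built from tuples $l_i=(l_{i1},\dots,l_{in_i})\in\mathbb{Z}_{\ge1}^{n_i}$, $0\le i\le r$, whose $i$-th row ($1\le i\le r$) is $(-l_0,0,\dots,0,l_i,0,\dots,0)$ with $l_i$ in the $i$-th column block (blocks numbered $0,\dots,r$). In $\mathbb{K}[T_{ij},S_k;\,0\le i\le r,\,1\le j\le n_i,\,1\le k\le m]$ put $T_i^{l_i}=T_{i1}^{l_{i1}}\cdots T_{in_i}^{l_{in_i}}$ and for $I=(i_1,i_2,i_3)$, $0\le i_1<i_2<i_3\le r$, $$g_I=\det\begin{bmatrix}T_{i_1}^{l_{i_1}}&T_{i_2}^{l_{i_2}}&T_{i_3}^{l_{i_3}}\\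 a_{i_1}&a_{i_2}&a_{i_3}\end{bmatrix}.$$ $R(A,P_0)=\mathbb{K}[T_{ij},S_k]/\langle g_I\rangle$ (all $I$), graded by $K_0=\mathbb{Z}^{n+m}/\mathrm{im}(P_0^* )$ ($P_0^*$ the transpose), the degrees of $T_{ij},S_k$ being the classes of the canonical basis vectors $e_{ij},e_k$. Derivations: for an integral algebra $R=\bigoplus_{w\in K_0}R_w$, a derivation $\delta$ is a $\mathbb{K}$-linear map satisfying the Leibniz rule; it is locally nilpotent if every $f\in R$ is killed by some power of $\delta$; it is $K_0$-homogeneous if it maps each $R_w$ into some $R_{w'}$, and then it has a degree $\deg(\delta)\in K_0$ with $\delta(R_w)\subseteq R_{w+\deg(\delta)}$. The weight cone is the convex cone in $K_0\otimes\mathbb{Q}$ generated by all $w$ with $R_w\ne0$. A homogeneous $\delta$ is primitive if $\deg(\delta)$ does not lie in the weight cone. Let $Q(R)_0$ be the subfield of $Q(R)$ of fractions $f/g$ with $f,g$ homogeneous of the same degree; $\delta$ (extended to $Q(R)$) is of vertical type if $\delta(Q(R)_0)=0$ and of horizontal type otherwise. Derivations $\delta_{C,\beta}$: the input is a sequence $C=(c_0,\dots,c_r)$ with $1\le c_i\le n_i$ and a nonzero vector $\beta=(\beta_0,\dots,\beta_r)\in\mathbb{K}^{r+1}$ in the row space of $[a_0,\dots,a_r]$ (then either all entries of $\beta$ are nonzero, or there is a unique $i_0$ with $\beta_{i_0}=0$). Case 1: all $\beta_i\ne0$, and there is at most one $i_1$ with $l_{i_1c_{i_1}}>1$. Then $\delta_{C,\beta}(T_{ic_i})=\beta_i\prod_{k\ne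 i}\frac{\partial T_k^{l_k}}{\partial T_{kc_k}}$, $\delta_{C,\beta}(T_{ij})=0$ for $j\ne c_i$, $\delta_{C,\beta}(S_k)=0$ for all $k$. Case 2: $\beta_{i_0}=0$ is the unique zero entry, and there is at most one $i_1\ne i_0$ with $l_{i_1c_{i_1}}>1$. Then $\delta_{C,\beta}(T_{ic_i})=\beta_i\prod_{k\ne i,i_0}\frac{\partial T_k^{l_k}}{\partial T_{kc_k}}$, $\delta_{C,\beta}(T_{ij})=0$ for $j\ne c_i$, $\delta_{C,\beta}(S_k)=0$ for all $k$. These define primitive $K_0$-homogeneous locally nilpotent derivations of $R(A,P_0)$. *)

(* Defs.v *)
From HB Require Import structures.
From mathcomp Require Import all_boot all_order all_algebra.
From mathcomp Require Import mpoly.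
From mathcomp Require Import boolp.

Set Implicit Arguments.
Unset Strict Implicit.
Unset Printing Implicit Defensive.

Import GRing.Theory Num.Theory.

Local Open Scope ring_scope.
Local Open Scope quotient_scope.

(* The data r, n_0, ..., n_r, m, A = [a_0, ..., a_r] and l_ij of R(A, P_0).
   The variables T_i1, ..., T_in_i are numbered from 0 to n_i - 1, and
   S_1, ..., S_m from 0 to m - 1. *)
Record trinomial_data (K : fieldType) := TrinomialData {
  td_r : nat;
  td_n : 'I_td_r.+1 -> nat;
  td_m : nat;
  td_A : 'M[K]_(2, td_r.+1);
  td_l : forall i, 'I_(td_n i) -> nat;
  td_r_gt0 : (0 < td_r)%N;
  td_n_gt0 : forall i, (0 < td_n i)%N;
  td_A_free : forall i j, i != j -> free [:: col i td_A; col j td_A];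
  td_l_gt0 : forall i j, (0 < td_l (i := i) j)%N
}.

Section TrinomialRing.

Variables (K : fieldType) (X : trinomial_data K).

Local Notation r := (td_r X).
Local Notation n := (@td_n K X).
Local Notation m := (td_m X).
Local Notation A := (td_A X).
Local Notation l := (@td_l K X _).

Definition var : finType := ({i : 'I_r.+1 & 'I_(n i)} + 'I_m)%type.
Definition nvar : nat := #|var|.
Definition idxT (i : 'I_r.+1) (j : 'I_(n i)) : 'I_nvar :=
  enum_rank (inl (Tagged (fun i => 'I_(n i)) j) : var).
Definition idxS (k : 'I_m) : 'I_nvar := enum_rank (inr k : var).

Definition monT (i : 'I_r.+1) : {mpoly K[nvar]} :=
  \prod_(j < n i) 'X_(idxT j) ^+ l j.

Definition relg (i1 i2 i3 : 'I_r.+1) : {mpoly K[nvar]} :=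
  let I (s : 'I_3) := tnth [tuple i1; i2; i3] s in
  \det (col_mx (\row_(s < 3) monT (I s))
               (\matrix_(p < 2, s < 3) (A p (I s))%:MP) : 'M_3).

Definition ideal_g (p : {mpoly K[nvar]}) : bool :=
  `[< exists q : 'I_r.+1 -> 'I_r.+1 -> 'I_r.+1 -> {mpoly K[nvar]},
      p = \sum_(i1 < r.+1) \sum_(i2 < r.+1 | (i1 < i2)%N)
          \sum_(i3 < r.+1 | (i2 < i3)%N)
            q i1 i2 i3 * relg i1 i2 i3 >].

Lemma relg_at0 i1 i2 i3 : (relg i1 i2 i3).@[fun=> 0] = 0.
Proof.
have monT0 i : (monT i).@[fun=> 0] = 0.
  rewrite rmorph_prod /= (bigD1 (Ordinal (td_n_gt0 i))) //=.
  by rewrite rmorphXn /= mevalXU expr0n (gtn_eqF (td_l_gt0 _)) mul0r.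
rewrite /relg -det_map_mx (expand_det_row _ (lshift 2 (ord0 : 'I_1))).
apply: big1 => s _; rewrite mxE (@col_mxEu _ 1 2) mxE.
by rewrite [X in X * _]monT0 mul0r.
Qed.

Lemma ideal_g_closed : idealr_closed ideal_g.
Proof.
split.
- apply/asboolP; exists (fun _ _ _ => 0).
  by do 3![rewrite big1 // => ? _]; rewrite mul0r.
- apply/asboolP => -[q /(congr1 (meval (fun=> 0)))].
  rewrite meval1 raddf_sum big1 => [|i1 _]; first by move/eqP; rewrite oner_eq0.
  rewrite raddf_sum big1 => // i2 _; rewrite raddf_sum big1 => // i3 _.
  by rewrite /= mevalM relg_at0 mulr0.
- move=> a u v /asboolP[q ->] /asboolP[q' ->]; apply/asboolP.
  exists (fun i1 i2 i3 => a * q i1 i2 i3 + q' i1 i2 i3).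
  rewrite mulr_sumr -big_split; apply: eq_bigr => i1 _ /=.
  rewrite mulr_sumr -big_split; apply: eq_bigr => i2 _ /=.
  rewrite mulr_sumr -big_split; apply: eq_bigr => i3 _ /=.
  by rewrite mulrDl mulrA.
Qed.

HB.instance Definition _ := isIdealr.Build {mpoly K[nvar]} ideal_g ideal_g_closed.

Definition trinomial_ideal : idealr {mpoly K[nvar]} := ideal_g.

(* The ring R(A, P_0). *)
Definition trinomial_ring : Type := {ideal_quot trinomial_ideal}.
HB.instance Definition _ := GRing.ComNzRing.on trinomial_ring.

Definition piR (p : {mpoly K[nvar]}) : trinomial_ring :=
  \pi_({ideal_quot trinomial_ideal}) p.

Lemma piR_is_zmod_morphism : zmod_morphism piR.
Proof. by move=> p q; exact: raddfB. Qed.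
Lemma piR_is_monoid_morphism : monoid_morphism piR.
Proof. by split=> [|p q]; [exact: rmorph1 | exact: rmorphM]. Qed.
HB.instance Definition _ := GRing.isZmodMorphism.Build
  {mpoly K[nvar]} trinomial_ring piR piR_is_zmod_morphism.
HB.instance Definition _ := GRing.isMonoidMorphism.Build
  {mpoly K[nvar]} trinomial_ring piR piR_is_monoid_morphism.

Definition scaleR (a : K) (f : trinomial_ring) : trinomial_ring :=
  piR a%:MP * f.

Lemma scaleRA a b f : scaleR a (scaleR b f) = scaleR (a * b) f.
Proof. by rewrite /scaleR mulrA -rmorphM -mpolyCM. Qed.
Lemma scale1R : left_id 1 scaleR.
Proof. by move=> f; rewrite /scaleR rmorph1 mul1r. Qed.
Lemma scaleRDr : right_distributive scaleR +%R.
Proof. by move=> a f g; rewrite /scaleR mulrDr. Qed.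
Lemma scaleRDl f : {morph scaleR^~ f : a b / a + b}.
Proof. by move=> a b; rewrite /scaleR mpolyCD rmorphD mulrDl. Qed.
HB.instance Definition _ := GRing.Zmodule_isLmodule.Build K trinomial_ring
  scaleRA scale1R scaleRDr scaleRDl.

Lemma scaleRAl (a : K) (f g : trinomial_ring) : a *: (f * g) = (a *: f) * g.
Proof. exact: mulrA. Qed.
HB.instance Definition _ := GRing.Lmodule_isLalgebra.Build K trinomial_ring
  scaleRAl.

Definition genT (i : 'I_r.+1) (j : 'I_(n i)) : trinomial_ring := piR 'X_(idxT j).
Definition genS (k : 'I_m) : trinomial_ring := piR 'X_(idxS k).

Definition P0 : 'M[int]_(r, nvar) :=
  \matrix_(i, v) match enum_val v with
    | inl (existT i' j) =>
        if i' == ord0 then - (l j)%:Z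
        else if i' == lift ord0 i then (l j)%:Z else 0
    | inr _ => 0
    end.

(* Elements of Z^(n+m) are rows, so that the transpose of P_0 acts as
   x |-> x *m P_0. *)
Definition imP0 (u : 'rV[int]_nvar) : bool :=
  `[< exists x : 'rV[int]_r, u = x *m P0 >].

Lemma imP0_closed : zmod_closed imP0.
Proof.
split; first by apply/asboolP; exists 0; rewrite mul0mx.
move=> u v /asboolP[x ->] /asboolP[y ->]; apply/asboolP.
by exists (x - y); rewrite mulmxBl.
Qed.
HB.instance Definition _ := GRing.isZmodClosed.Build _ imP0 imP0_closed.

Definition K0_rel : zmodClosed 'rV[int]_nvar := GRing.ZmodClosed.clone _ imP0 _.
Definition K0 : Type := Quotient.quot K0_rel.
HB.instance Definition _ := GRing.Zmodule.on K0.

Definition piK0 (u : 'rV[int]_nvar) : K0 := \pi_(Quotient.quot K0_rel) u.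

Definition monK0 (mu : 'X_{1..nvar}) : K0 := piK0 (\row_v (mu v)%:Z).

(* graded_piece w is the homogeneous component R_w. *)
Definition graded_piece (w : K0) (f : trinomial_ring) : Prop :=
  exists2 p : {mpoly K[nvar]}, f = piR p & {in msupp p, forall mu, monK0 mu = w}.

(* K_0 (x) Q is the quotient of Q^(n+m) by the rational row space of P_0, and
   multiplication by cokermx embeds this quotient into Q^(n+m). *)
Definition K0Q (w : K0) : 'rV[rat]_nvar :=
  map_mx intr (repr (w : Quotient.quot K0_rel)) *m cokermx (map_mx intr P0).

Lemma K0Q_pi u : K0Q (piK0 u) = map_mx intr u *m cokermx (map_mx intr P0).
Proof.
apply/eqP; rewrite -subr_eq0 -mulmxBl -map_mxB -submxE.
have : repr (piK0 u : Quotient.quot K0_rel) - u \in imP0.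
  by rewrite Quotient.idealrBE reprK.
by case/asboolP=> x ->; rewrite map_mxM submxMl.
Qed.

Definition weight_cone (x : 'rV[rat]_nvar) : Prop :=
  exists (k : nat) (w : 'I_k -> K0) (c : 'I_k -> rat),
    [/\ forall s, 0 <= c s,
        forall s, exists2 f, graded_piece (w s) f & f != 0
      & x = \sum_s c s *: K0Q (w s)].

Implicit Types delta : trinomial_ring -> trinomial_ring.

Definition derivation delta : Prop :=
  linear delta /\ forall f g, delta (f * g) = delta f * g + f * delta g.

Definition locally_nilpotent delta : Prop :=
  forall f, exists k, iter k delta f = 0.

Definition homogeneous delta : Prop :=
  forall w, exists w', forall f, graded_piece w f -> graded_piece w' (delta f).

Definition has_degree delta (d : K0) : Prop :=
  forall w f, graded_piece w f -> graded_piece (w + d) (delta f).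

Definition primitive delta : Prop :=
  exists2 d, has_degree delta d & ~ weight_cone (K0Q d).

(* R(A, P_0) is integral, and the extension of delta to Q(R) is given by
   delta (f / g) = (delta f * g - f * delta g) / g ^+ 2, which vanishes if and
   only if its numerator does; see vertical_typeP. *)
Definition vertical_type delta : Prop :=
  forall w f g, graded_piece w f -> graded_piece w g -> g != 0 ->
    delta f * g - f * delta g = 0.

Definition horizontal_type delta : Prop := ~ vertical_type delta.

Lemma vertical_typeP delta (F : fieldType) (iota : {rmorphism trinomial_ring -> F})
    (D : F -> F) :
    injective iota ->
    (forall x y, D (x + y) = D x + D y) ->
    (forall x y, D (x * y) = D x * y + x * D y) ->
    (forall f, D (iota f) = iota (delta f)) ->
  vertical_type delta <->
  forall w f g, graded_piece w f -> graded_piece w g -> g != 0 -> D (iota f / iota g) = 0.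
Proof.
move=> iotaI _ DM Diota.
have DE f g : g != 0 ->
    D (iota f / iota g) = iota (delta f * g - f * delta g) / iota g ^+ 2.
  move=> g0; have ig0 : iota g != 0 by rewrite -(rmorph0 iota) (inj_eq iotaI).
  have := DM (iota f / iota g) (iota g); rewrite divfK // !Diota => E.
  apply: (mulIf (expf_neq0 2 ig0)); rewrite divfK ?expf_neq0 // expr2 mulrA.
  rewrite -[D _ * _](addrK (iota f / iota g * iota (delta g))) -E.
  by rewrite mulrBl rmorphB !rmorphM mulrAC divfK.
split=> H w f g hf hg g0; first by rewrite DE // (H w) // rmorph0 mul0r.
have ig0 : iota g != 0 by rewrite -(rmorph0 iota) (inj_eq iotaI).
apply: iotaI; apply: (mulIf (invr_neq0 (expf_neq0 2 ig0))).
by rewrite -DE // (H w) // rmorph0 mul0r.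
Qed.

(* f lies in the subalgebra generated by all T_ij and the S_k with k != k0 *)
Definition indep_of_S (k0 : 'I_m) (f : trinomial_ring) : Prop :=
  exists2 p : {mpoly K[nvar]},
    f = piR p & {in msupp p, forall mu : 'X_{1..nvar}, mu (idxS k0) = 0%N}.

Section DeltaCBeta.

Variables (c : forall i : 'I_r.+1, 'I_(n i)) (beta : 'rV[K]_r.+1).

Definition dmonT (k : 'I_r.+1) : {mpoly K[nvar]} := (monT k)^`M(idxT (c k)).

(* Stated as a relation: a derivation of R(A, P_0) is determined by its values on
   the generators T_ij and S_k. *)
Definition derivation_with_values (v : 'I_r.+1 -> trinomial_ring) delta : Prop :=
  [/\ derivation delta,
      forall i (j : 'I_(n i)), delta (genT j) = if j == c i then v i else 0
    & forall k, delta (genS k) = 0].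

Variant delta_CB_cases delta : Prop :=
| DeltaCase1 of
    forall i, beta 0 i != 0
  & (#|[set i1 | (1 < l (c i1))%N]| <= 1)%N
  & derivation_with_values
      (fun i => beta 0 i *: piR (\prod_(k | k != i) dmonT k)) delta
| DeltaCase2 (i0 : 'I_r.+1) of
    forall i, (beta 0 i == 0) = (i == i0)
  & (#|[set i1 | (i1 != i0) && (1 < l (c i1))%N]| <= 1)%N
  & derivation_with_values
      (fun i => beta 0 i *: piR (\prod_(k | (k != i) && (k != i0)) dmonT k)) delta.

Definition is_delta_CB delta : Prop :=
  [/\ beta != 0, (beta <= A)%MS & delta_CB_cases delta].

End DeltaCBeta.

End TrinomialRing.

(* Main.v *)
Require Import Defs.
From HB Require Import structures.
From mathcomp Require Import all_boot all_order all_algebra.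
From mathcomp Require Import mpoly boolp ring zify.

Set Implicit Arguments.
Unset Strict Implicit.
Unset Printing Implicit Defensive.

Import Order.TTheory GRing.Theory Num.Theory.

Local Open Scope ring_scope.

(* Let A_0, A_1 be the rows of A. The relations say that the vector of the Y_i = T_i^{l_i} is
   x A_0 + y A_1 for two elements x, y of the ring. Hence every homogeneous element is a monomial
   times a binary form in x, y, and evaluation at points shows that nonzero homogeneous elements
   have nonzero products.

   Let d = deg(delta). Primitivity says that no monomial has degree d, so a monomial of degree
   deg(T_v) + d does not contain T_v, and a monomial of degree deg(Y_i) + d is not divisible by any
   Y_k; the latter piece is therefore spanned by a single monomial M. If delta(S_k0) is nonzero,
   comparing exponents of S_k0 shows that delta kills all other generators, and delta is vertical.
   Otherwise delta(Y_i) = beta_i M with beta in the row space of A, and delta(T_ij) is a multiple of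
   M T_ij / Y_i, nonzero for at most one j = c_i. Dividing M by the partial derivatives of the Y_i
   with beta_i nonzero gives h. If delta is vertical, then beta_i Y_k = beta_k Y_i, so beta = 0.
   Finally, two exponents l_ic_i > 1 would make T_ic_i and T_kc_k divide each other's images, which
   is impossible for a locally nilpotent derivation. *)

(** * The relations g_I, the elements x and y, and evaluation at points *)

Section Relations.

Variables (K : fieldType) (X : trinomial_data K).

Local Notation r := (td_r X).
Local Notation n := (@td_n K X).
Local Notation m := (td_m X).
Local Notation A := (td_A X).
Local Notation l := (@td_l K X _).
Local Notation N := (nvar X).
Local Notation mpol := {mpoly K[N]}.

Lemma var_ind (P : 'I_N -> Prop) :
    (forall i (j : 'I_(n i)), P (idxT j)) -> (forall k, P (idxS k)) ->
  forall v, P v.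
Proof.
move=> PT PS v; rewrite -[v]enum_valK.
by case: (enum_val v) => [[i j]|k]; [exact: PT | exact: PS].
Qed.

Lemma idxT_eq i (j j' : 'I_(n i)) : (idxT j == idxT j') = (j == j').
Proof.
apply/eqP/eqP => [|->//] /enum_rank_inj [].
by move/eqP; rewrite eq_Tagged => /eqP.
Qed.

Lemma idxT_neq i i' (j : 'I_(n i)) (j' : 'I_(n i')) :
  i != i' -> (idxT j == idxT j') = false.
Proof.
by move=> ii'; apply/eqP => /enum_rank_inj [] /eqP; rewrite (negPf ii').
Qed.

Lemma idxS_eq (k k' : 'I_m) : (idxS k == idxS k') = (k == k').
Proof. by apply/eqP/eqP => [/enum_rank_inj []|->]. Qed.

Lemma idxTS i (j : 'I_(n i)) k : (idxT j == idxS k) = false.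
Proof. by apply/eqP => /enum_rank_inj. Qed.

Definition expT (i : 'I_r.+1) : 'X_{1..N} :=
  [multinom match enum_val v with
            | inl (existT i' j) => if i' == i then l j else 0%N
            | inr _ => 0%N
            end | v < N].

Lemma expT_T i i' (j : 'I_(n i')) : expT i (idxT j) = if i' == i then l j else 0%N.
Proof. by rewrite mnmE enum_rankK. Qed.

Lemma expT_S i k : expT i (idxS k) = 0%N.
Proof. by rewrite mnmE enum_rankK. Qed.

Lemma mnm1_le_expT i (j : 'I_(n i)) : (U_(idxT j) <= expT i)%MM.
Proof.
apply/mnm_lepP => v; rewrite mnm1E; case: eqP => [<-|//].
by rewrite expT_T eqxx td_l_gt0.
Qed.

Lemma monTE i : monT i = 'X_[expT i].
Proof.
rewrite /monT; under eq_bigr => j _ do rewrite mpolyXn.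
rewrite -(big_morph _ (@mpolyXD _ _) (mpolyX0 _ _)); congr 'X_[_]; apply/mnmP => v.
rewrite mnm_sumE.
under eq_bigr => j _ do rewrite mulmnE mnm1E.
elim/var_ind: v => [i' j'|k]; last first.
  by rewrite expT_S big1 // => j _; rewrite idxTS.
rewrite expT_T; case: (eqVneq i' i) => [ii'|ii']; last first.
  by rewrite big1 // => j _; rewrite idxT_neq // eq_sym.
move: j'; rewrite ii' => j'; rewrite (bigD1 j') //= eqxx mul1n big1 ?addn0 //.
by move=> j jj'; rewrite idxT_eq (negPf jj').
Qed.

Lemma dmonTE (c : forall i, 'I_(n i)) i :
  dmonT c i = (l (c i))%:R *: 'X_[expT i - U_(idxT (c i))].
Proof. by rewrite /dmonT monTE mderivX expT_T eqxx. Qed.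

Lemma monT_meval (t : 'I_N -> K) i : (monT i).@[t] = \prod_(j < n i) t (idxT j) ^+ l j.
Proof. by rewrite rmorph_prod; apply: eq_bigr => j _; rewrite rmorphXn /= mevalXU. Qed.

Definition minor (i j : 'I_r.+1) : K := A 0 i * A 1 j - A 0 j * A 1 i.

(** If the minor vanished, [(A 1 j, - A 1 i)] and [(A 0 j, - A 0 i)] would be coefficients of
    relations between columns i and j, so column j would be zero, which is itself a relation. *)
Lemma minor_neq0 i j : i != j -> minor i j != 0.
Proof.
move=> /td_A_free fA; apply/eqP => D0.
have /freeP fA' : free [tuple col i A; col j A] by [].
have H (a b : K) : a *: col i A + b *: col j A = 0 -> a = 0 /\ b = 0.
  move=> E; have := fA' (fun s => tnth [tuple a; b] s).
  rewrite big_ord_recl big_ord1 /= !(tnth_nth 0) /= => /(_ E) H.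
  by split; [have := H 0 | have := H 1]; rewrite (tnth_nth 0).
have col0 (a b : K) : a * A 0 i + b * A 0 j = 0 -> a * A 1 i + b * A 1 j = 0 ->
    a *: col i A + b *: col j A = 0.
  move=> E0 E1; apply/matrixP => p q; rewrite !mxE.
  have /orP[/eqP->|/eqP->] : (p == 0) || (p == 1) by case: p => [[|[|]]].
    exact: E0.
  exact: E1.
have [Aj1 _] : A 1 j = 0 /\ - A 1 i = 0.
  apply/H/col0; last by ring.
  by rewrite -[RHS]D0 /minor; ring.
have [Aj0 _] : A 0 j = 0 /\ - A 0 i = 0.
  apply/H/col0; first by ring.
  by rewrite -[RHS]oppr0 -D0 /minor; ring.
have [_ /eqP] : (0 : K) = 0 /\ (1 : K) = 0.
  by apply/H/col0; rewrite ?Aj0 ?Aj1; ring.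
by rewrite oner_eq0.
Qed.

Lemma det_mx22 (R : comPzRingType) (M : 'M[R]_2) :
  \det M = M 0 0 * M 1 1 - M 0 1 * M 1 0.
Proof.
rewrite (expand_det_row _ 0) !big_ord_recl big_ord0 /cofactor !det_mx11 !mxE /=.
rewrite !expr0 !expr1 addr0 mul1r mulN1r mulrN.
by congr (_ * M _ _ - M _ _ * M _ _); apply: val_inj.
Qed.

Lemma det_mx33 (R : comPzRingType) (M : 'M[R]_3) :
  let o0 : 'I_3 := 0 in let o1 : 'I_3 := 1 in let o2 : 'I_3 := ord_max in
  \det M = M o0 o0 * (M o1 o1 * M o2 o2 - M o1 o2 * M o2 o1)
         - M o0 o1 * (M o1 o0 * M o2 o2 - M o1 o2 * M o2 o0)
         + M o0 o2 * (M o1 o0 * M o2 o1 - M o1 o1 * M o2 o0).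
Proof.
move=> o0 o1 o2; rewrite (expand_det_row _ 0) !big_ord_recl big_ord0 /cofactor.
rewrite !det_mx22 !mxE.
rewrite /= /bump /= !expr0 expr1 sqrrN expr1n addr0 !mul1r mulN1r mulrN addrA.
by congr (M _ _ * (M _ _ * M _ _ - M _ _ * M _ _) - M _ _ * (M _ _ * M _ _ - M _ _ * M _ _)
   + M _ _ * (M _ _ * M _ _ - M _ _ * M _ _)); apply: val_inj.
Qed.

Lemma relgE i1 i2 i3 : relg i1 i2 i3 =
  monT i1 * (minor i2 i3)%:MP - monT i2 * (minor i1 i3)%:MP
  + monT i3 * (minor i1 i2)%:MP.
Proof.
rewrite /relg det_mx33.
have -> : (0 : 'I_3) = lshift 2 (0 : 'I_1) by apply: val_inj.
have -> : (1 : 'I_3) = rshift 1 (0 : 'I_2) by apply: val_inj.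
have -> : (ord_max : 'I_3) = rshift 1 (1 : 'I_2) by apply: val_inj.
rewrite !(@col_mxEu _ 1 2) !(@col_mxEd _ 1 2) !mxE !(tnth_nth i1) /=.
by rewrite /minor !mpolyCB !mpolyCM; ring.
Qed.

Lemma piR_relg (i1 i2 i3 : 'I_r.+1) :
  (i1 < i2 < i3)%N -> piR (relg i1 i2 i3) = 0.
Proof.
move=> /andP[i12 i23]; apply/eqP; rewrite -(rmorph0 (@piR K X)) -Quotient.idealrBE.
rewrite subr0; apply/asboolP.
exists (fun j1 j2 j3 => ([&& j1 == i1, j2 == i2 & j3 == i3])%:R).
move: (@relg K X) => g.
rewrite (bigD1 i1) //= (bigD1 i2) //= (bigD1 i3) //= !eqxx mul1r.
rewrite big1 ?addr0 => [|j3 /andP[_ /negPf->]]; last by rewrite mul0r.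
rewrite big1 ?addr0 => [|j2 /andP[_ /negPf->]]; last first.
  by rewrite big1 // => j3 _; rewrite mul0r.
rewrite big1 ?addr0 // => j1 /negPf->.
by rewrite big1 // => j2 _; rewrite big1 // => j3 _; rewrite mul0r.
Qed.

Lemma piR_eq0 (p : mpol) : piR p = 0 -> exists q : 'I_r.+1 -> 'I_r.+1 -> 'I_r.+1 -> mpol,
  p = \sum_(i1 < r.+1) \sum_(i2 < r.+1 | (i1 < i2)%N)
      \sum_(i3 < r.+1 | (i2 < i3)%N) q i1 i2 i3 * relg i1 i2 i3.
Proof.
by move=> /eqP; rewrite -(rmorph0 (@piR K X)) -Quotient.idealrBE subr0 => /asboolP.
Qed.

Definition mono (mu : 'X_{1..N}) : trinomial_ring X := piR 'X_[mu].

Lemma monoD mu nu : mono (mu + nu) = mono mu * mono nu.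
Proof. by rewrite /mono mpolyXD rmorphM. Qed.

Lemma mul_scaleR (a : K) (f g : trinomial_ring X) : f * (a *: g) = a *: (f * g).
Proof. by rewrite mulrC -scalerAl mulrC. Qed.

Lemma piRZ a p : piR (a *: p) = a *: piR p :> trinomial_ring X.
Proof. by rewrite -mul_mpolyC rmorphM. Qed.

Lemma piR_mono p : piR p = \sum_(mu <- msupp p) p@_mu *: mono mu :> trinomial_ring X.
Proof.
by rewrite {1}[p]mpolyE rmorph_sum; apply: eq_bigr => mu _; rewrite /= piRZ.
Qed.

Let j0 : 'I_r.+1 := ord0.
Let j1 : 'I_r.+1 := Ordinal (td_r_gt0 X : 1 < r.+1)%N.

(* The solution x, y of T_i^{l_i} = (A 0 i) x + (A 1 i) y for i = 0, 1. *)
Definition coordx : mpol :=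
  (minor j0 j1)^-1 *: (A 1 j1 *: 'X_[expT j0] - A 1 j0 *: 'X_[expT j1]).
Definition coordy : mpol :=
  (minor j0 j1)^-1 *: (A 0 j0 *: 'X_[expT j1] - A 0 j1 *: 'X_[expT j0]).

Lemma piRBZ a b c p q :
  piR (c *: (a *: p - b *: q)) = (c * a) *: piR p - (c * b) *: piR q :> trinomial_ring X.
Proof. by rewrite piRZ rmorphB /= !piRZ scalerBr !scalerA. Qed.

(** For i other than 0 and 1 this is the relation g_(0,1,i); for these two indices one minor on the
    right is zero. *)
Lemma expT_rel i : minor j0 j1 *: mono (expT i) =
  minor i j1 *: mono (expT j0) + minor j0 i *: mono (expT j1).
Proof.
have [->|i0] := eqVneq i j0.
  by rewrite [minor j0 j0]subrr scale0r addr0.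
have [->|i1] := eqVneq i j1.
  by rewrite [minor j1 j1]subrr scale0r add0r.
have := @piR_relg j0 j1 i; rewrite relgE !monTE /=.
have -> : (1 < i)%N by move: i0 i1; rewrite -!val_eqE /=; case: (val i) => [|[]].
move=> /(_ isT); rewrite !(mulrC 'X_[_]) !mul_mpolyC rmorphD rmorphB /= !piRZ.
rewrite -!/(mono _) => /eqP; rewrite addrC addr_eq0 => /eqP ->.
rewrite opprB addrC -scaleNr; congr (_ *: _ + _).
by rewrite /minor; ring.
Qed.

(** Cramer's rule: multiplied by [minor j0 j1], the claim becomes [expT_rel]. *)
Lemma mono_expT i : mono (expT i) = A 0 i *: piR coordx + A 1 i *: piR coordy.
Proof.
have D0 : minor j0 j1 != 0 by exact: minor_neq0.
apply: (can_inj (scalerK D0)); rewrite expT_rel /coordx /coordy !piRBZ.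
rewrite -[piR 'X_[expT j0]]/(mono (expT j0)) -[piR 'X_[expT j1]]/(mono (expT j1)).
move: (mono _) (mono _) => u v.
have E a b : minor j0 j1 * a * ((minor j0 j1)^-1 * b) = a * b.
  by rewrite mulrACA divff // mul1r.
rewrite !(scalerDr, scalerN, scalerA) !E [X in _ = _ + X]addrC addrACA.
by rewrite [X in _ = _ + X]addrC -!scalerBl; congr (_ *: _ + _ *: _); rewrite /minor; ring.
Qed.

(* Points of the zero set of the g_I, off all coordinate hyperplanes, with x = z and y = 1. *)
Definition on_curve (t : 'I_N -> K) (z : K) :=
  (forall v, t v != 0) /\ (forall i, (monT i).@[t] = A 0 i * z + A 1 i).

Lemma on_curve_relg t z i1 i2 i3 : on_curve t z -> (relg i1 i2 i3).@[t] = 0.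
Proof.
move=> [_ tz]; rewrite relgE rmorphD rmorphB /= !mevalM !mevalC !tz /minor; ring.
Qed.

Lemma on_curve_piR t z p q : on_curve t z -> piR p = piR q -> p.@[t] = q.@[t].
Proof.
move=> tz /eqP; rewrite -subr_eq0 -rmorphB => /eqP /piR_eq0 [g E].
apply/eqP; rewrite -subr_eq0 -mevalB E.
rewrite raddf_sum big1 // => i1 _; rewrite raddf_sum big1 // => i2 _.
by rewrite raddf_sum big1 // => i3 _; rewrite /= mevalM (on_curve_relg _ _ _ tz) mulr0.
Qed.

Lemma on_curve_coordx t z : on_curve t z -> coordx.@[t] = z.
Proof.
move=> tz; have [_ tE] := tz.
rewrite /coordx mevalZ mevalB !mevalZ -!monTE !tE.
apply: (canLR (mulKf (minor_neq0 (isT : j0 != j1)))); rewrite /minor; ring.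
Qed.

Lemma on_curve_coordy t z : on_curve t z -> coordy.@[t] = 1.
Proof.
move=> tz; have [_ tE] := tz.
rewrite /coordy mevalZ mevalB !mevalZ -!monTE !tE.
apply: (canLR (mulKf (minor_neq0 (isT : j0 != j1)))); rewrite /minor; ring.
Qed.

End Relations.

(** * The grading by K_0 and the shape of its homogeneous components *)

Section Grading.

Variables (K : fieldType) (X : trinomial_data K).

Local Notation r := (td_r X).
Local Notation n := (@td_n K X).
Local Notation m := (td_m X).
Local Notation l := (@td_l K X _).
Local Notation N := (nvar X).
Local Notation x := (piR (coordx X)).
Local Notation y := (piR (coordy X)).

Lemma monK0D mu nu : monK0 (mu + nu)%MM = monK0 mu + monK0 nu :> K0 X.
Proof.
rewrite /monK0 /piK0 -raddfD; congr (\pi_(_) _)%qT.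
by apply/rowP => v; rewrite !mxE mnmDE PoszD.
Qed.

Lemma monK0B mu nu : (nu <= mu)%MM -> monK0 (mu - nu)%MM = monK0 mu - monK0 nu :> K0 X.
Proof. by move=> le; apply/eqP; rewrite eq_sym subr_eq -monK0D submK. Qed.

Lemma monK0P mu nu :
  monK0 mu = monK0 nu :> K0 X <->
  exists z : 'rV[int]_r, \row_v (mu v)%:Z - \row_v (nu v)%:Z = z *m P0 X.
Proof.
rewrite /monK0 /piK0; split.
  by move=> /eqP; rewrite -Quotient.idealrBE => /asboolP.
by move=> H; apply/eqP; rewrite -Quotient.idealrBE; apply/asboolP.
Qed.

Lemma monK0_S mu nu k : monK0 mu = monK0 nu :> K0 X -> mu (idxS k) = nu (idxS k).
Proof.
case/monK0P => z /rowP /(_ (idxS k)); rewrite !mxE big1.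
  by move/eqP; rewrite subr_eq0 eqz_nat => /eqP.
by move=> p _; rewrite mxE enum_rankK mulr0.
Qed.

(** The row of P_0 belonging to block i adds l_i there and subtracts l_0 in block 0. Hence z_0 is
    minus the sum of the other z_i. *)
Lemma monK0_T mu nu : monK0 mu = monK0 nu :> K0 X ->
  exists2 z : 'I_r.+1 -> int, \sum_i z i = 0 &
    forall i (j : 'I_(n i)), (mu (idxT j))%:Z = (nu (idxT j))%:Z + z i * (l j)%:Z.
Proof.
case/monK0P => z /rowP E.
exists (fun i => if unlift ord0 i is Some p then z 0 p else - \sum_p z 0 p).
  rewrite big_ord_recl unlift_none addrC.
  by under eq_bigr => p _ do rewrite liftK; rewrite subrr.
move=> i j; apply/eqP; rewrite addrC -subr_eq; apply/eqP.
have := E (idxT j); rewrite !mxE => ->.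
under eq_bigr => p _ do rewrite mxE enum_rankK /=.
move: (l j) => L.
case: unliftP => [p|] ip.
  have -> : (i == ord0) = false by rewrite ip.
  rewrite (bigD1 p) //= ip eqxx big1 ?addr0 // => q qp.
  by rewrite (inj_eq lift_inj) eq_sym (negPf qp) mulr0.
rewrite ip eqxx mulNr mulr_suml -sumrN.
by apply: eq_bigr => p _; rewrite mulrN.
Qed.

Lemma monK0_expT i i' : monK0 (expT i) = monK0 (expT i') :> K0 X.
Proof.
suff E i1 : monK0 (expT i1) = monK0 (expT ord0) :> K0 X by rewrite E.
case: (unliftP ord0 i1) => [p|] -> //.
apply/monK0P; exists (delta_mx 0 p); rewrite -rowE; apply/rowP.
elim/var_ind => [i2 j|k]; rewrite !mxE enum_rankK ?expT_T ?expT_S ?subr0 //=.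
move: (l j) => L; case: (eqVneq i2 ord0) => [->|i20]; first by rewrite sub0r.
by rewrite subr0; case: eqP.
Qed.

(* u is what is left of mu0 once the T_i^{l_i} are divided out as often as possible. *)
Lemma monK0_decomp (mu0 : 'X_{1..N}) : exists (u : 'X_{1..N}) (k : nat), forall mu,
    monK0 mu = monK0 mu0 :> K0 X ->
  exists2 e : 'I_r.+1 -> nat, mu = (u + \sum_i expT i *+ e i)%MM & (\sum_i e i)%N = k.
Proof.
pose P i k := [forall j : 'I_(n i), (k * l j <= mu0 (idxT j))%N].
have P0 i : exists k, P i k by exists 0%N; apply/forallP => j.
have Pmax i k : P i k -> (k <= mu0 (idxT (Ordinal (td_n_gt0 i))))%N.
  by move/forallP/(_ (Ordinal (td_n_gt0 i))); apply: leq_trans; rewrite leq_pmulr // td_l_gt0.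
pose q i := ex_maxn (P0 i) (Pmax i).
have qP i (j : 'I_(n i)) : (q i * l j <= mu0 (idxT j))%N.
  by rewrite /q; case: ex_maxnP => k /forallP.
have qmax i k : P i k -> (k <= q i)%N.
  by rewrite /q; case: ex_maxnP => k' _; apply.
have sumT (e : 'I_r.+1 -> nat) i (j : 'I_(n i)) :
    (\sum_i expT i *+ e i)%MM (idxT j) = (e i * l j)%N.
  rewrite mnm_sumE (bigD1 i) //= big1 ?addn0 => [|i' ii'].
    by rewrite mulmnE expT_T eqxx mulnC.
  by rewrite mulmnE expT_T eq_sym (negPf ii') mul0n.
have sumS (e : 'I_r.+1 -> nat) k : (\sum_i expT i *+ e i)%MM (idxS k) = 0%N.
  by rewrite mnm_sumE big1 // => i' _; rewrite mulmnE expT_S mul0n.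
exists (mu0 - \sum_i expT i *+ q i)%MM, (\sum_i q i)%N => mu E.
have [z z0 zE] := monK0_T E; have ES := monK0_S _ E.
(* [q i + z i] will be the exponent of T_i^{l_i} in [mu]. Were it negative, the nonnegative
   exponents of [mu] would force [mu0] to be divisible by one more power of T_i^{l_i}, against the
   maximality of [q i]. *)
have z_ge i : 0 <= (q i)%:Z + z i.
  rewrite leNgt; apply/negP => lt0.
  suff /qmax : P i (q i).+1 by rewrite ltnn.
  apply/forallP => j; have := zE i j; have := td_l_gt0 j.
  by nia.
exists (fun i => absz ((q i)%:Z + z i)).
  apply/mnmP; elim/var_ind => [i j|k].
    rewrite mnmDE mnmBE !sumT; have := zE i j; have := z_ge i; have := qP i j; nia.
  by rewrite mnmDE mnmBE !sumS addn0 subn0.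
apply/eqP; rewrite -eqz_nat; apply/eqP.
rewrite !(big_morph Posz PoszD (erefl _)); under eq_bigr => i _ do rewrite gez0_abs //.
by rewrite big_split /= z0 addr0.
Qed.

(* The span of the x^s y^(k-s); every graded piece is a monomial times a subspace of it. *)
Definition binform k (g : trinomial_ring X) :=
  exists c : nat -> K, g = \sum_(s < k.+1) c s *: (x ^+ s * y ^+ (k - s)).

Lemma binform1 : binform 0 1.
Proof. by exists (fun=> 1); rewrite big_ord1 scale1r !expr0 mulr1. Qed.

Lemma binformD k g g' : binform k g -> binform k g' -> binform k (g + g').
Proof.
move=> [c ->] [c' ->]; exists (fun s => c s + c' s).
by rewrite -big_split; apply: eq_bigr => s _; rewrite scalerDl.
Qed.

Lemma binformZ k a g : binform k g -> binform k (a *: g).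
Proof.
move=> [c ->]; exists (fun s => a * c s).
by rewrite scaler_sumr; apply: eq_bigr => s _; rewrite scalerA.
Qed.

(** T_i^{l_i} is a linear form in x and y; multiplication by x shifts the coefficients by one,
    multiplication by y appends a zero. *)
Lemma binform_expT k i g : binform k g -> binform k.+1 (mono (expT i) * g).
Proof.
move=> Bg; rewrite mono_expT mulrDl -!scalerAl; apply: binformD; apply: binformZ.
- case: Bg => c ->; exists (fun s => if s is s'.+1 then c s' else 0).
  rewrite [RHS]big_ord_recl /= scale0r add0r mulr_sumr; apply: eq_bigr => s _.
  by rewrite subSS mul_scaleR exprS mulrA.
- case: Bg => c ->; exists (fun s => if (s <= k)%N then c s else 0).
  rewrite [RHS]big_ord_recr /= ltnn scale0r addr0 mulr_sumr; apply: eq_bigr => s _ /=.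
  have sk : (s <= k)%N by rewrite -ltnS.
  by rewrite sk subSn // mul_scaleR exprS mulrCA.
Qed.

Lemma binform_mono (e : 'I_r.+1 -> nat) :
  binform (\sum_i e i) (mono (\sum_i expT i *+ e i)).
Proof.
elim: (index_enum _) => [|i s IH].
  by rewrite !big_nil /mono mpolyX0 rmorph1; exact: binform1.
rewrite !big_cons; elim: (e i) => [|k IHk].
  by rewrite add0n mulm0n add0m.
by rewrite addSn mulmS -addmA monoD; apply: binform_expT.
Qed.

(** All monomials of one degree share the same [u] and [k] in [monK0_decomp], so their cofactors are
    forms of the same degree k and can be added. *)
Lemma graded_binform w f : graded_piece w f ->
  exists u k, exists2 g, binform k g & f = mono u * g.
Proof.
case=> p -> wp; case: (msupp p) (piR_mono p) wp => [|mu0 s] -> wp.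
  exists 0%MM, 0%N, 0; last by rewrite big_nil mulr0.
  by exists (fun=> 0); rewrite big_ord1 scale0r.
have [u [k dec]] := monK0_decomp mu0; exists u, k.
have : {in mu0 :: s, forall mu : 'X_{1..N}, monK0 mu = monK0 mu0 :> K0 X}.
  by move=> mu /wp ->; rewrite wp ?mem_head.
elim: (mu0 :: s) => [|mu s' IH] ws.
  exists 0; last by rewrite big_nil mulr0.
  exists (fun=> 0); rewrite big1 // => s' _; exact: scale0r.
have [|g Bg E] := IH; first by move=> nu nus; apply: ws; rewrite in_cons nus orbT.
have [|e -> ek] := dec mu; first by apply: ws; rewrite mem_head.
exists (p@_(u + \sum_i expT i *+ e i)%MM *: mono (\sum_i expT i *+ e i) + g).
  by apply: binformD => //; apply: binformZ; rewrite -ek; apply: binform_mono.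
by rewrite big_cons E mulrDr mul_scaleR -monoD.
Qed.

Lemma graded_mono mu : graded_piece (monK0 mu) (mono mu : trinomial_ring X).
Proof.
by exists 'X_[mu] => // nu; rewrite msuppX inE => /eqP ->.
Qed.

End Grading.

(** * Nonvanishing of products of homogeneous elements *)

Section Nonvanishing.

Variables (K : closedFieldType) (X : trinomial_data K).

Local Notation r := (td_r X).
Local Notation A := (td_A X).
Local Notation l := (@td_l K X _).
Local Notation N := (nvar X).
Local Notation mpol := {mpoly K[N]}.

(** A z is chosen off the roots of F and of the polynomials A_0i X + A_1i, which are nonzero because
    no column of A is zero. In each block the first variable is then a suitable root of the value at
    z, and all other variables are 1. *)
Lemma exists_on_curve (F : {poly K}) : F != 0 ->
  exists z (t : 'I_N -> K), on_curve t z /\ F.[z] != 0.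
Proof.
move=> F0; pose p i : {poly K} := A 0 i *: 'X + (A 1 i)%:P.
have p0 i : p i != 0.
  have [i' ii'] : exists i', i != i'.
    exists (if i == ord0 then Ordinal (td_r_gt0 X : 1 < r.+1)%N else ord0).
    by case: (eqVneq i ord0) => [->|].
  apply: contraNneq (minor_neq0 ii') => pi0; rewrite /minor.
  have := congr1 (fun q : {poly K} => q`_0) pi0.
  have := congr1 (fun q : {poly K} => q`_1) pi0.
  rewrite /p !coefD !coefZ !coefX !coefC /= !mulr1 !mulr0 addr0 add0r => -> ->.
  by rewrite mul0r mulr0 subr0.
have /closed_nonrootP [z] : F * \prod_i p i != 0.
  by rewrite mulf_neq0 //; apply/prodf_neq0 => i _.
rewrite rootE hornerM mulf_eq0 negb_or horner_prod => /andP[Fz /prodf_neq0 pz].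
have root_ex i : exists t, t ^+ l (Ordinal (td_n_gt0 i)) = (p i).[z].
  have /closed_rootP [t] : size ('X^(l (Ordinal (td_n_gt0 i))) - (p i).[z]%:P) != 1%N.
    by rewrite size_XnsubC ?td_l_gt0 // eqSS -lt0n td_l_gt0.
  by rewrite rootE !hornerE subr_eq0 => /eqP ?; exists t.
have [t tE] := fin_all_exists root_ex.
exists z, (fun v => match enum_val v with
  | inl (existT i j) => if j == Ordinal (td_n_gt0 i) then t i else 1
  | inr _ => 1 end); split=> //; split.
  elim/var_ind => [i j|k]; rewrite enum_rankK ?oner_eq0 //.
  case: ifP => _; rewrite ?oner_eq0 //.
  have := pz i isT; rewrite -tE expf_eq0 td_l_gt0; exact: contra.
move=> i; rewrite monT_meval (bigD1 (Ordinal (td_n_gt0 i))) //= enum_rankK /= tE.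
rewrite big1 ?mulr1 => [|j /negPf j0]; last by rewrite enum_rankK /= j0 expr1n.
by rewrite !hornerE.
Qed.

Lemma mono_on_curve (t : 'I_N -> K) z mu : on_curve t z -> ('X_[mu] : mpol).@[t] != 0.
Proof.
move=> [t0 _]; rewrite mevalX; apply/prodf_neq0 => v _.
by rewrite expf_neq0.
Qed.

(** F is the binary form of f dehomogenized at y = 1: at a curve point, f takes the nonzero value of
    a monomial times F(z). *)
Lemma graded_nonvanishing w f : graded_piece w f -> f != 0 ->
  exists2 F : {poly K}, F != 0 & forall p (t : 'I_N -> K) z,
    piR p = f -> on_curve t z -> F.[z] != 0 -> p.@[t] != 0.
Proof.
move=> /graded_binform [u [k [g [c ->] ->]]] f0.
exists (\poly_(s < k.+1) c s).
  apply: contraNneq f0 => P0; rewrite big1 ?mulr0 // => s _.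
  have := congr1 (fun q : {poly K} => q`_s) P0.
  by rewrite coef_poly ltn_ord coef0 => ->; rewrite scale0r.
move=> p t z E tz Fz.
pose p' : mpol := 'X_[u] * \sum_(s < k.+1) c s *: (coordx X ^+ s * coordy X ^+ (k - s)).
have : piR p = piR p'.
  rewrite E rmorphM rmorph_sum; congr (_ * _); apply: eq_bigr => s _ /=.
  by rewrite [RHS]piRZ rmorphM !rmorphXn.
move/(on_curve_piR tz)->; rewrite mevalM mulf_neq0 ?(mono_on_curve _ tz) //.
rewrite raddf_sum /=; move: Fz; congr (_ != 0); rewrite horner_poly.
apply: eq_bigr => s _; rewrite mevalZ mevalM !rmorphXn /=.
by rewrite (on_curve_coordx tz) (on_curve_coordy tz) expr1n mulr1.
Qed.

(** This stands in for the integrality of R: both dehomogenizations are nonzero polynomials, so some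
    curve point avoids the roots of their product. *)
Lemma graded_mul_neq0 w w' (f g : trinomial_ring X) :
  graded_piece w f -> graded_piece w' g -> f != 0 -> g != 0 -> f * g != 0.
Proof.
move=> hf hg f0 g0.
have [F F0 FP] := graded_nonvanishing hf f0; have [G G0 GP] := graded_nonvanishing hg g0.
have [z [t [tz]]] := exists_on_curve (mulf_neq0 F0 G0).
rewrite hornerM mulf_eq0 negb_or => /andP[Fz Gz].
case: hf FP => p -> _ FP; case: hg GP => q -> _ GP.
apply/eqP; rewrite -rmorphM -(rmorph0 (@piR K X)) => /(on_curve_piR tz).
apply/eqP; rewrite mevalM raddf0 mulf_neq0 //.
  exact: (FP p t z).
exact: (GP q t z).
Qed.

Lemma mono_neq0 mu : mono mu != 0 :> trinomial_ring X.
Proof.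
have [z [t [tz _]]] := exists_on_curve (oner_neq0 {poly K}).
apply/eqP; rewrite /mono -(rmorph0 (@piR K X)) => /(on_curve_piR tz)/eqP.
by rewrite raddf0 (negPf (mono_on_curve _ tz)).
Qed.

(** At a curve point T_i^{l_i} takes the value A_0i z + A_1i; for distinct i and k these polynomials
    in z are linearly independent, as the minor is nonzero. *)
Lemma mono_expT_free mu i k (a b : K) : i != k ->
  mono mu * (a *: mono (expT i) + b *: mono (expT k)) = 0 :> trinomial_ring X ->
  a = 0 /\ b = 0.
Proof.
move=> ik E.
have F0 : (a * A 0 i + b * A 0 k) *: 'X + (a * A 1 i + b * A 1 k)%:P = 0 :> {poly K}.
  apply/eqP/negPn/negP => /exists_on_curve [z [t [tz]]].
  have := on_curve_piR (p := 'X_[mu] * (a *: 'X_[expT i] + b *: 'X_[expT k])) (q := 0) tz.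
  rewrite rmorph0 rmorphM rmorphD /= !piRZ -!/(mono _) => /(_ E).
  rewrite mevalM mevalD !mevalZ -!monTE raddf0 => /eqP.
  rewrite mulf_eq0 (negPf (mono_on_curve _ tz)) /=; case: tz => _ tE.
  rewrite !tE !hornerE => /eqP H /negP; apply; rewrite -[X in _ == X]H; apply/eqP => /=; ring.
have E0 := congr1 (fun q : {poly K} => q`_0) F0.
have E1 := congr1 (fun q : {poly K} => q`_1) F0.
move: E0 E1; rewrite !coefD !coefZ !coefX !coefC /= !mulr1 !mulr0 addr0 add0r => E1 E0.
have /negPf D0 := minor_neq0 ik.
split; apply/eqP.
  have : a * minor i k == 0.
    apply/eqP; transitivity ((a * A 0 i + b * A 0 k) * A 1 k - (a * A 1 i + b * A 1 k) * A 0 k).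
      rewrite /minor; ring.
    by rewrite E0 E1 !mul0r subrr.
  by rewrite mulf_eq0 D0 orbF.
have : b * minor i k == 0.
  apply/eqP; transitivity ((a * A 1 i + b * A 1 k) * A 0 i - (a * A 0 i + b * A 0 k) * A 1 i).
    rewrite /minor; ring.
  by rewrite E0 E1 !mul0r subrr.
by rewrite mulf_eq0 D0 orbF.
Qed.

End Nonvanishing.

(** * Derivations determined by their values on the variables *)

Section Derivations.

Variables (K : fieldType) (X : trinomial_data K).

Local Notation N := (nvar X).
Local Notation mpol := {mpoly K[N]}.
Local Notation R := (trinomial_ring X).

Implicit Types delta : R -> R.

Lemma derD delta f g : derivation delta -> delta (f + g) = delta f + delta g.
Proof. by move=> [lin _]; have := lin 1 f g; rewrite !scale1r. Qed.

Lemma der0 delta : derivation delta -> delta 0 = 0.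
Proof. by move=> der; apply: (addrI (delta 0)); rewrite -derD // !addr0. Qed.

Lemma derZ delta a f : derivation delta -> delta (a *: f) = a *: delta f.
Proof. by move=> der; have := der.1 a f 0; rewrite (der0 der) !addr0. Qed.

Lemma der_sum delta I (s : seq I) (F : I -> R) : derivation delta ->
  delta (\sum_(i <- s) F i) = \sum_(i <- s) delta (F i).
Proof.
by move=> der; apply: (big_morph _ _ (der0 der)) => f g; exact: derD.
Qed.

Lemma der1 delta : derivation delta -> delta 1 = 0.
Proof.
by move=> [_ dM]; apply: (addrI (delta 1)); have := dM 1 1; rewrite !mulr1 mul1r addr0 => <-.
Qed.

(** The derivation from the polynomial ring to R, along [piR], that sends each variable X_v to
    [V v]. *)
Definition chain (V : 'I_N -> R) (p : mpol) : R := \sum_v piR p^`M(v) * V v.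

Lemma chainD V p q : chain V (p + q) = chain V p + chain V q.
Proof.
by rewrite -big_split; apply: eq_bigr => v _; rewrite mderivD rmorphD mulrDl.
Qed.

Lemma chainZ V a p : chain V (a *: p) = a *: chain V p.
Proof.
by rewrite scaler_sumr; apply: eq_bigr => v _; rewrite mderivZ piRZ scalerAl.
Qed.

Lemma chainM V p q : chain V (p * q) = chain V p * piR q + piR p * chain V q.
Proof.
rewrite mulr_suml mulr_sumr -big_split; apply: eq_bigr => v _.
by rewrite mderivM rmorphD !rmorphM /= mulrDl -!mulrA [piR q * _]mulrC.
Qed.

Lemma chain0 V : chain V 0 = 0.
Proof. by rewrite /chain big1 // => v _; rewrite mderiv0 rmorph0 mul0r. Qed.

Lemma chain_sum V I (s : seq I) (P : pred I) (F : I -> mpol) :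
  chain V (\sum_(i <- s | P i) F i) = \sum_(i <- s | P i) chain V (F i).
Proof. exact: (big_morph _ (chainD V) (chain0 V)). Qed.

Lemma chain_mono V mu :
  chain V 'X_[mu] = \sum_v (mu v)%:R *: (mono (mu - U_(v)) * V v).
Proof. by apply: eq_bigr => v _; rewrite mderivX piRZ scalerAl. Qed.

Lemma chain1 V : chain V 1 = 0.
Proof. by rewrite -mpolyX0 chain_mono big1 // => v _; rewrite mnm0E scale0r. Qed.

Lemma chain_var V v : chain V 'X_v = V v.
Proof.
rewrite chain_mono (bigD1 v) //= big1 ?addr0 => [|v' /negPf vv'].
  have -> : (U_(v) - U_(v) = 0)%MM by apply/mnmP => w; rewrite mnmBE mnm0E subnn.
  by rewrite mnm1E eqxx scale1r /mono mpolyX0 rmorph1 mul1r.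
by rewrite mnm1E eq_sym vv' scale0r.
Qed.

Lemma der_piR delta p : derivation delta ->
  delta (piR p) = chain (fun v => delta (piR 'X_v)) p.
Proof.
move=> der; have dM := der.2.
elim/mpolyind: p => [|c mu p _ _ IH]; first by rewrite rmorph0 chain0 der0.
rewrite rmorphD /= derD // chainD {}IH piRZ derZ // chainZ; congr (_ *: _ + _).
rewrite mpolyXE_id; elim/big_ind: _ => [|p1 p2 IH1 IH2|v _].
- by rewrite rmorph1 der1 // chain1.
- by rewrite rmorphM dM chainM IH1 IH2.
elim: (mu v) => [|k IH].
  by rewrite expr0 rmorph1 der1 // chain1.
by rewrite exprS rmorphM dM chainM IH chain_var.
Qed.

Lemma piR_repr (f : R) : piR (repr f) = f.
Proof. exact: reprK. Qed.

Lemma der_ext delta delta' : derivation delta -> derivation delta' ->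
  (forall v, delta (piR 'X_v) = delta' (piR 'X_v)) -> delta =1 delta'.
Proof.
move=> der der' E f; rewrite -(piR_repr f) !der_piR //.
by apply: eq_bigr => v _; rewrite E.
Qed.

Lemma der_mulZ delta h : derivation delta -> derivation (fun f => h * delta f).
Proof.
move=> [lin dM]; split=> [a f g|f g]; first by rewrite lin mulrDr mul_scaleR.
by rewrite dM mulrDr mulrA [h * (f * _)]mulrCA.
Qed.

Lemma sum_var (Z : nmodType) (F : 'I_N -> Z) :
  \sum_v F v = \sum_i \sum_(j < td_n i) F (idxT j) + \sum_k F (idxS k).
Proof.
rewrite (reindex (@enum_rank (var X))) /=; last first.
  by exists enum_val => v _; [exact: enum_rankK | exact: enum_valK].
rewrite big_sumType /=; congr (_ + _).
rewrite (sig_big_dep _ (fun _ _ => true) (fun i j => F (idxT j))) /=.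
by apply: eq_big => [[i j]|[i j] _].
Qed.

Lemma chain_expT V i : chain V 'X_[expT i] =
  \sum_(j < td_n i) (td_l j)%:R *: (mono (expT i - U_(idxT j)) * V (idxT j)).
Proof.
rewrite chain_mono sum_var [X in _ + X]big1 ?addr0 => [|k _]; last first.
  by rewrite expT_S scale0r.
rewrite (bigD1 i) //= [X in _ + X]big1 ?addr0 => [|i' ii'].
  by apply: eq_bigr => j _; rewrite expT_T eqxx.
by rewrite big1 // => j _; rewrite expT_T (negPf ii') scale0r.
Qed.

(** Independent of the chosen representatives once [chain V] kills the g_I, as [mkder_piR] shows. *)
Definition mkder (V : 'I_N -> R) (f : R) : R := chain V (repr f).

Section Mkder.

Variable V : 'I_N -> R.
Hypothesis V_relg : forall i1 i2 i3, chain V (relg i1 i2 i3) = 0.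

(** By the Leibniz rule [chain V] kills every multiple of g_I, since both g_I and its image are zero
    in R. *)
Lemma mkder_piR p : mkder V (piR p) = chain V p.
Proof.
suff chain_ker q : piR q = 0 :> R -> chain V q = 0.
  apply/eqP; rewrite -subr_eq0 -scaleN1r -chainZ -chainD scaleN1r; apply/eqP/chain_ker.
  by rewrite rmorphB /= piR_repr subrr.
case/piR_eq0 => g ->; rewrite chain_sum big1 // => i1 _.
rewrite chain_sum big1 // => i2 i12; rewrite chain_sum big1 // => i3 i23.
by rewrite chainM V_relg piR_relg ?i12 // !mulr0 addr0.
Qed.

Lemma mkder_der : derivation (mkder V).
Proof.
split=> [a f g|f g]; rewrite -(piR_repr f) -(piR_repr g).
  by rewrite -piRZ -rmorphD !mkder_piR chainD chainZ.
by rewrite -rmorphM !mkder_piR chainM.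
Qed.

End Mkder.

End Derivations.

(** * Locally nilpotent derivations and nilpotency orders *)

Section LocallyNilpotent.

Variables (K : closedFieldType) (charK : [pchar K] =i pred0) (X : trinomial_data K).
Local Notation R := (trinomial_ring X).

Variables (delta : R -> R) (d : K0 X).
Hypotheses (der : derivation delta) (deg_d : has_degree delta d) (lnd : locally_nilpotent delta).

(** Every other term of the iterated Leibniz formula differentiates f more than a times or g more
    than b times. The induction on a + b uses Pascal's rule. *)
Lemma der_iter_mul a b f g :
  iter a.+1 delta f = 0 -> iter b.+1 delta g = 0 ->
  iter (a + b) delta (f * g) = 'C(a + b, a)%:R *: (iter a delta f * iter b delta g).
Proof.
have dM := der.2; have iterD s u v : iter s delta (u + v) = iter s delta u + iter s delta v.
  by elim: s u v => //= s IH u v; rewrite IH derD.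
have iter0 s : iter s delta 0 = 0 by elim: s => //= s ->; rewrite der0.
move Es: (a + b)%N => s; elim: s a b Es f g => [|s IH] a b Es f g fa gb.
  by move: Es fa gb => /eqP; rewrite addn_eq0 => /andP[/eqP-> /eqP->]; rewrite scale1r.
rewrite iterSr dM iterD.
(* If a or b is zero, one of the two Leibniz terms vanishes and the binomial coefficient is 1. *)
case: a Es fa => [|a] Es fa.
  rewrite [delta f]fa mul0r iter0 add0r bin0 scale1r /=.
  case: b Es gb => // b [Es] gb.
  rewrite (IH 0 b) -?iterSr //.
  by rewrite bin0 scale1r.
case: b Es gb => [|b] Es gb.
  rewrite [delta g]gb mulr0 iter0 addr0; move: Es; rewrite addn0 => -[E].
  by rewrite (IH a 0%N) ?addn0 -?iterSr // E !binn.
move: Es; rewrite addSn => -[Es].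
rewrite (IH a b.+1) -?iterSr // (IH a.+1 b) -?iterSr //; last by rewrite addSnnS.
by rewrite binS natrD scalerDl addrC.
Qed.

(** The value k at f of the degree function attached to a locally nilpotent derivation; 0 has
    none. *)
Definition order_at (f : R) k := iter k delta f != 0 /\ iter k.+1 delta f = 0.

Lemma order_at_uniq f k k' : order_at f k -> order_at f k' -> k = k'.
Proof.
have iter0 s : iter s delta 0 = 0 by elim: s => //= s ->; rewrite der0.
have lt a b : order_at f a -> order_at f b -> (b <= a)%N.
  move=> [_ fa] [fb _]; rewrite leqNgt; apply/negP => ab.
  by move: fb; rewrite -(subnK ab) iterD fa iter0 eqxx.
by move=> fk fk'; apply/eqP; rewrite eqn_leq !lt.
Qed.

Lemma order_at_ex f : f != 0 -> exists k, order_at f k.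
Proof.
move=> f0; have ex : exists k, iter k delta f == 0.
  by have [k fk] := lnd f; exists k; apply/eqP.
case: (ex_minnP ex) => -[|k] fk min; first by rewrite /= (negPf f0) in fk.
exists k; split; last exact/eqP.
by apply/negP => /min; rewrite ltnn.
Qed.

Lemma order_at_der f k : order_at f k.+1 -> order_at (delta f) k.
Proof. by rewrite /order_at -!iterSr. Qed.

Lemma graded_iter w f k : graded_piece w f -> graded_piece (w + d *+ k) (iter k delta f).
Proof.
move=> hf; elim: k => [|k IH]; first by rewrite addr0.
by rewrite mulrSr addrA; apply: deg_d.
Qed.

(** Characteristic zero keeps the binomial coefficient in [der_iter_mul] nonzero; the last nonzero
    iterates are homogeneous, so their product is nonzero too. *)
Lemma order_atM w w' f g k k' : graded_piece w f -> graded_piece w' g ->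
  order_at f k -> order_at g k' -> order_at (f * g) (k + k').
Proof.
move=> hf hg [f0 fk] [g0 gk]; have E := der_iter_mul fk gk; split; last first.
  rewrite iterS E derZ // der.2 -!iterS fk gk mul0r mulr0 addr0.
  exact: scaler0.
have /negPf C0 : 'C(k + k', k)%:R != 0 :> K.
  by rewrite (iffLR (pcharf0P K) charK) -lt0n bin_gt0 leq_addr.
apply/eqP; rewrite E => /(congr1 (fun u => ('C(k + k', k)%:R : K)^-1 *: u)).
rewrite scaler0 scalerK ?C0 //; apply/eqP.
exact: graded_mul_neq0 (graded_iter k hf) (graded_iter k' hg) f0 g0.
Qed.

Lemma order_at_div w w' f g k : graded_piece w f -> graded_piece w' g -> f * g != 0 ->
  order_at f k -> exists2 k', order_at (f * g) k' & (k <= k')%N.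
Proof.
move=> hf hg fg0 fk; have [|k' gk'] := @order_at_ex g.
  by apply: contraNneq fg0 => ->; rewrite mulr0.
by exists (k + k')%N; rewrite ?leq_addr //; apply: order_atM hf hg _ _.
Qed.

(* If f divides delta g and g divides delta f, comparing nilpotency orders gives
   ord f < ord g < ord f. *)
Lemma der_cross_div wf wg wp wq (f g p q : R) :
  graded_piece wf f -> graded_piece wg g -> graded_piece wp p -> graded_piece wq q ->
  delta f = g * p -> delta g = f * q -> delta f != 0 -> delta g = 0.
Proof.
move=> hf hg hp hq Ef Eg df0; apply/eqP/negPn/negP => dg0.
have ord_pos u : delta u != 0 -> exists k, order_at u k.+1.
  move=> du0; have [|[|k] uk] := @order_at_ex u.
  - by apply: contraNneq du0 => ->; rewrite der0.
  - by case: uk du0 => _ /= ->; rewrite eqxx.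
  by exists k.
have [kf fk] := ord_pos _ df0; have [kg gk] := ord_pos _ dg0.
have fk' : order_at (g * p) kf by rewrite -Ef; apply: order_at_der.
have gk' : order_at (f * q) kg by rewrite -Eg; apply: order_at_der.
have gp0 : g * p != 0 by have := df0; rewrite Ef; exact.
have fq0 : f * q != 0 by have := dg0; rewrite Eg; exact.
have [k1 /(order_at_uniq fk') <- lt1] := order_at_div hg hp gp0 gk.
have [k2 /(order_at_uniq gk') <- lt2] := order_at_div hf hq fq0 fk.
by have := leq_trans lt1 (ltnW lt2); rewrite ltnn.
Qed.

End LocallyNilpotent.

(** * Consequences of primitivity *)

Section Primitive.

Variables (K : closedFieldType) (X : trinomial_data K).

Local Notation n := (@td_n K X).
Local Notation l := (@td_l K X _).
Local Notation N := (nvar X).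
Local Notation R := (trinomial_ring X).

Variables (delta : R -> R) (d : K0 X).
Hypotheses (der : derivation delta) (deg_d : has_degree delta d).
Hypothesis prim : ~ weight_cone (K0Q d).

(** Monomials are nonzero in R, so their degrees lie in the weight cone. *)
Lemma primitive_mono mu : monK0 mu <> d.
Proof.
move=> E; apply: prim; exists 1%N, (fun=> d), (fun=> 1); split=> // [_|].
  by exists (mono mu); [rewrite -E; apply: graded_mono | apply: mono_neq0].
by rewrite big_ord1 scale1r.
Qed.

Lemma primitive_le mu nu : monK0 mu = monK0 nu + d -> ~~ (nu <= mu)%MM.
Proof.
move=> E; apply/negP => le; apply: (@primitive_mono (mu - nu)%MM).
by rewrite monK0B // E addrAC subrr add0r.
Qed.

Lemma target_free mu v : monK0 mu = monK0 U_(v) + d -> mu v = 0%N.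
Proof. by move/primitive_le; rewrite lep1mP negbK => /eqP. Qed.

Lemma der_varE v : exists2 p, delta (piR 'X_v) = piR p &
  {in msupp p, forall mu, monK0 mu = monK0 U_(v) + d}.
Proof. by have [p] := deg_d (graded_mono U_(v)); exists p. Qed.

Lemma der_var_target v : delta (piR 'X_v) != 0 ->
  exists mu, monK0 mu = monK0 U_(v) + d.
Proof.
have [p -> pP] := der_varE v; case: (msupp p) (piR_mono p) pP => [|mu s] ->.
  by rewrite big_nil eqxx.
by move=> pP _; exists mu; apply: pP; rewrite mem_head.
Qed.

(** If both images were nonzero, take monomials mu and nu of the degrees of the images of S_k0 and
    X_v. Then mu X_v and nu S_k0 have equal degree, but S_k0 occurs only in the second, while its
    exponent is determined by the degree. *)
Lemma der_genS_only k0 v : delta (genS k0) != 0 -> v != idxS k0 -> delta (piR 'X_v) = 0.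
Proof.
move=> /der_var_target [mu Emu] vk0; apply/eqP/negPn/negP => /der_var_target [nu Enu].
have : monK0 (mu + U_(v))%MM = monK0 (nu + U_(idxS k0))%MM :> K0 X.
  by rewrite !monK0D Emu Enu [RHS]addrC -addrA [d + _]addrC.
move/(monK0_S k0); rewrite !mnmDE !mnm1E (negPf vk0) eqxx (target_free Emu).
by rewrite addn1.
Qed.

Lemma indep_of_S_der_genS k0 : indep_of_S k0 (delta (genS k0)).
Proof.
have [p E pP] := der_varE (idxS k0); exists p => // mu /pP; exact: target_free.
Qed.

(** On monomials delta is the partial derivative in S_k0 times delta(S_k0). Monomials of equal
    degree have equal exponents of S_k0, hence the same logarithmic derivative. *)
Lemma vertical_of_genS k0 : delta (genS k0) != 0 -> vertical_type delta.
Proof.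
move=> dS w f g [p -> wp] [q -> wq] _.
have dE mu : delta (mono mu) = (mu (idxS k0))%:R *: (mono (mu - U_(idxS k0)) * delta (genS k0)).
  rewrite der_piR // chain_mono (bigD1 (idxS k0)) //= big1 ?addr0 // => v vk.
  by rewrite (der_genS_only dS vk) mulr0 scaler0.
suff mono_eq mu nu : monK0 mu = monK0 nu :> K0 X ->
    delta (mono mu) * mono nu = mono mu * delta (mono nu).
  rewrite !piR_mono !(der_sum _ _ der) !mulr_suml -sumrB big_seq big1 // => mu mup.
  rewrite !mulr_sumr -sumrB big_seq big1 // => nu nuq.
  rewrite !(derZ _ _ der) -!scalerAl !mul_scaleR mono_eq ?subrr //.
  by rewrite wp // wq.
move=> E; rewrite (dE mu) (dE nu) (monK0_S k0 E).
have [->|] := posnP (nu (idxS k0)); first by rewrite !scale0r mul0r mulr0.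
rewrite lt0n => nu0; rewrite -scalerAl mul_scaleR; congr (_ *: _).
rewrite mulrAC mulrA -!monoD; congr (mono _ * _).
have mu0 : (U_(idxS k0) <= mu)%MM by rewrite lep1mP (monK0_S k0 E).
by rewrite addmBA ?lep1mP // addmC addmBA // addmC.
Qed.

Hypothesis dS : forall k, delta (genS k) = 0.

(* Distinct monomials of the same degree differ by sum_i z_i l_i with sum_i z_i = 0, so some
   T_i^{l_i} divides one of them, and the quotient would have degree d. *)
Lemma target_uniq i mu nu :
  monK0 mu = monK0 (expT i) + d -> monK0 nu = monK0 (expT i) + d -> mu = nu.
Proof.
move=> Emu Enu; have E : monK0 mu = monK0 nu :> K0 X by rewrite Emu.
have [z z0 zE] := monK0_T E.
have z_le i' : z i' <= 0.
  rewrite leNgt; apply/negP => zi.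
  rewrite (monK0_expT i i') in Emu; have /negP := primitive_le Emu; apply.
  apply/mnm_lepP; elim/var_ind => [i2 j|k]; last by rewrite expT_S.
  rewrite expT_T; case: (eqVneq i2 i') => // ii'.
  move: j; rewrite {i2}ii' => j; have := zE i' j; nia.
have {}z0 i' : z i' = 0.
  apply/eqP; rewrite -oppr_eq0; apply/eqP.
  apply: (@psumr_eq0P _ _ xpredT (fun i => - z i)) => // [i2 _|].
    by rewrite oppr_ge0.
  by rewrite sumrN z0 oppr0.
apply/mnmP; elim/var_ind => [i' j|k]; last exact: monK0_S E.
by have := zE i' j; rewrite z0 mul0r addr0 => -[].
Qed.

Lemma target_genT i (j : 'I_(n i)) mu : monK0 mu = monK0 U_(idxT j) + d ->
  monK0 (mu + (expT i - U_(idxT j)))%MM = monK0 (expT i) + d.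
Proof.
move=> E; rewrite monK0D monK0B ?mnm1_le_expT // E addrC -addrA; congr (_ + _).
by rewrite addrA addNr add0r.
Qed.

Section Target.

Variable M : 'X_{1..N}.
Hypothesis degM : monK0 M = monK0 (expT ord0) + d.

(** A monomial of delta(T_ij) times T_i^{l_i} / T_ij has the degree of M, hence equals M by
    [target_uniq]. Since T_ij does not occur in that monomial, its exponent in M is l_ij - 1. *)
Lemma der_genT i (j : 'I_(n i)) : exists a : K,
  delta (genT j) = a *: mono (M - (expT i - U_(idxT j))) /\
  (a != 0 -> (expT i - U_(idxT j) <= M)%MM /\ (M (idxT j)).+1 = l j).
Proof.
have [p E pP] := der_varE (idxT j).
have suppE : {in msupp p, forall mu : 'X_{1..N}, mu + (expT i - U_(idxT j)) = M}%MM.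
  move=> mu /pP /target_genT; rewrite (monK0_expT i ord0).
  by move/target_uniq; apply.
(* By [suppE] the support has at most one element; the sum also covers the empty support, with value
   0. *)
exists (\sum_(mu <- msupp p) p@_mu); split=> [|a0].
  rewrite /genT E piR_mono scaler_suml !big_seq; apply: eq_bigr => mu /suppE <-.
  by rewrite addmK.
have [mu mup] : exists mu, mu \in msupp p.
  case: (msupp p) a0 => [|mu s]; first by rewrite big_nil eqxx.
  by exists mu; rewrite mem_head.
rewrite -(suppE mu mup); split; first exact: lem_addl.
rewrite mnmDE mnmBE (target_free (pP mu mup)) mnm1E eqxx expT_T eqxx.
by rewrite add0n subn1 prednK ?td_l_gt0.
Qed.

End Target.

End Primitive.

(** * The factorization through delta_{C,beta} when delta kills all S_k *)

Section Horizontal.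

Variables (K : closedFieldType) (charK : [pchar K] =i pred0) (X : trinomial_data K).

Local Notation r := (td_r X).
Local Notation n := (@td_n K X).
Local Notation A := (td_A X).
Local Notation l := (@td_l K X _).
Local Notation N := (nvar X).
Local Notation R := (trinomial_ring X).

Variables (delta : R -> R) (d : K0 X).
Hypotheses (der : derivation delta) (deg_d : has_degree delta d).
Hypothesis dS : forall k, delta (genS k) = 0.

Variables (M : 'X_{1..N}) (a : forall i : 'I_r.+1, 'I_(n i) -> K).
Hypothesis dT : forall i (j : 'I_(n i)),
  delta (genT j) = a j *: mono (M - (expT i - U_(idxT j))).
Hypothesis aM : forall i (j : 'I_(n i)), a j != 0 ->
  (expT i - U_(idxT j) <= M)%MM /\ (M (idxT j)).+1 = l j.

Lemma natr_l_neq0 i (j : 'I_(n i)) : (l j)%:R != 0 :> K.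
Proof. by rewrite (iffLR (pcharf0P K) charK) -lt0n td_l_gt0. Qed.

(** For j' different from j, [a j' != 0] makes T_i^{l_i} / T_ij' divide M, so T_ij has exponent at
    least l_ij in M, whereas [a j != 0] makes it l_ij - 1. *)
Lemma coef_uniq i (j j' : 'I_(n i)) : a j != 0 -> a j' != 0 -> j = j'.
Proof.
move=> /aM[_ Mj] /aM[/mnm_lepP/(_ (idxT j)) le _]; apply/eqP/negPn/negP => jj'.
by move: le; rewrite mnmBE mnm1E expT_T eqxx idxT_eq eq_sym (negPf jj') subn0 -Mj ltnn.
Qed.

(** If all coefficients in block i vanish, the default is the first index, and [beta i] is 0. *)
Definition pivot (i : 'I_r.+1) : 'I_(n i) :=
  if [pick j | a j != 0] is Some j then j else Ordinal (td_n_gt0 i).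

Local Notation c := pivot.

Lemma coef_pivot i (j : 'I_(n i)) : a j = if j == c i then a (c i) else 0.
Proof.
rewrite /pivot; case: pickP => [j' aj'|a0]; last by rewrite !(eqP (negbFE (a0 _))) if_same.
case: eqP => [->//|jj']; apply/eqP/negPn/negP => aj.
exact/jj'/coef_uniq.
Qed.

Definition beta i : K := (l (c i))%:R * a (c i).

Lemma beta_eq0 i : (beta i == 0) = (a (c i) == 0).
Proof. by rewrite mulf_eq0 (negPf (natr_l_neq0 _)). Qed.

Lemma der_expT i : delta (mono (expT i)) = beta i *: mono M.
Proof.
rewrite der_piR // chain_expT (bigD1 (c i)) //= big1 ?addr0 => [|j jc].
  rewrite dT mul_scaleR scalerA -monoD.
  have [a0|/aM[le _]] := eqVneq (a (c i)) 0; first by rewrite /beta a0 mulr0 !scale0r.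
  by rewrite addmC submK.
by rewrite dT coef_pivot (negPf jc) scale0r mulr0 scaler0.
Qed.

(** x and y are combinations of T_0^{l_0} and T_1^{l_1}, so delta maps them to multiples b0 and b1
    of M; then delta is applied to [mono_expT]. *)
Lemma beta_row : exists b0 b1, forall i, beta i = A 0 i * b0 + A 1 i * b1.
Proof.
have dB s u v i k : delta (piR (s *: (u *: 'X_[expT i] - v *: 'X_[expT k]))) =
    (s * u * beta i - s * v * beta k) *: mono M.
  rewrite piRBZ -scaleNr (derD _ _ der) !(derZ _ _ der) -!/(mono _) !der_expT.
  by rewrite !scalerA -scalerDl mulNr.
have [b0 dx] : exists b0, delta (piR (coordx X)) = b0 *: mono M by eexists; exact: dB.
have [b1 dy] : exists b1, delta (piR (coordy X)) = b1 *: mono M by eexists; exact: dB.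
exists b0, b1 => i; apply/eqP; rewrite -subr_eq0.
have : (beta i - (A 0 i * b0 + A 1 i * b1)) *: mono M = 0.
  rewrite scalerBl -der_expT mono_expT (derD _ _ der) !(derZ _ _ der) dx dy.
  by rewrite !scalerA scalerDl subrr.
by move/eqP; rewrite scaler_eq0 (negPf (mono_neq0 M)) orbF.
Qed.

(** Zeros at i and k form a homogeneous linear system for b0 and b1 with determinant [minor i k]. *)
Lemma beta_eq0_uniq i k : i != k -> beta i = 0 -> beta k = 0 -> forall p, beta p = 0.
Proof.
move=> ik bi bk p; have [b0 [b1 bE]] := beta_row.
have D0 : minor i k != 0 by exact: minor_neq0.
have b00 : b0 = 0.
  apply: (mulfI D0); rewrite mulr0.
  transitivity (beta i * A 1 k - beta k * A 1 i); first by rewrite !bE /minor; ring.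
  by rewrite bi bk !mul0r subrr.
have b10 : b1 = 0.
  apply: (mulfI D0); rewrite mulr0.
  transitivity (beta k * A 0 i - beta i * A 0 k); first by rewrite !bE /minor; ring.
  by rewrite bi bk !mul0r subrr.
by rewrite bE b00 b10 !mulr0 addr0.
Qed.

Lemma vertical_beta : vertical_type delta -> forall i, beta i = 0.
Proof.
move=> vert i.
have [k ik] : exists k, i != k.
  exists (if i == ord0 then Ordinal (td_r_gt0 X : 1 < r.+1)%N else ord0).
  by case: (eqVneq i ord0) => [->|].
have := vert _ _ _ (graded_mono (expT i)).
rewrite (monK0_expT i k) => /(_ _ (graded_mono (expT k)) (mono_neq0 _)).
rewrite !der_expT -scalerAl mul_scaleR [mono (expT i) * _]mulrC -!mul_scaleR -mulrBr.
rewrite addrC -scaleNr => /(mono_expT_free ik) [_]; exact.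
Qed.

Lemma prod_dmonT (P : pred 'I_r.+1) :
  piR (\prod_(k | P k) dmonT c k) =
  (\prod_(k | P k) (l (c k))%:R) *: mono (\sum_(k | P k) (expT k - U_(idxT (c k)))) :> R.
Proof.
elim/big_rec3: _ => [|k p mu b _ IH]; first by rewrite scale1r /mono mpolyX0.
by rewrite rmorphM /= IH dmonTE piRZ -scalerAl mul_scaleR scalerA monoD.
Qed.

(** One product serves both cases of delta_{C,beta}: the condition [beta k != 0] is void in Case 1
    and excludes i_0 in Case 2. *)
Definition cb_value i : R :=
  beta i *: piR (\prod_(k | (beta k != 0) && (k != i)) dmonT c k).

Definition cb_var (v : 'I_N) : R :=
  match enum_val v with
  | inl (existT i j) => if j == c i then cb_value i else 0
  | inr _ => 0
  end.

Lemma cb_varT i (j : 'I_(n i)) : cb_var (idxT j) = if j == c i then cb_value i else 0.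
Proof. by rewrite /cb_var enum_rankK. Qed.

Lemma cb_varS k : cb_var (idxS k) = 0.
Proof. by rewrite /cb_var enum_rankK. Qed.

Lemma chain_cb_monT i : chain cb_var (monT i) = beta i *: piR (\prod_(k | beta k != 0) dmonT c k).
Proof.
rewrite monTE chain_expT (bigD1 (c i)) //= big1 ?addr0 => [|j jc]; last first.
  by rewrite cb_varT (negPf jc) mulr0 scaler0.
rewrite cb_varT eqxx /cb_value mul_scaleR scalerA mulrC -scalerA.
have [->|bi] := eqVneq (beta i) 0; first by rewrite !scale0r.
by rewrite [in RHS](bigD1 i) //= rmorphM /= dmonTE piRZ -scalerAl.
Qed.

(** By [chain_cb_monT] the image is a common factor times the determinant g_I with its first row
    replaced by entries of beta, and beta lies in the row space of A. *)
Lemma chain_cb_relg i1 i2 i3 : chain cb_var (relg i1 i2 i3) = 0.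
Proof.
have [b0 [b1 bE]] := beta_row.
rewrite relgE -mulrN -mpolyCN ![monT _ * _]mulrC !mul_mpolyC !chainD !chainZ !chain_cb_monT.
rewrite !scalerA -!scalerDl !bE /minor.
apply/eqP; rewrite scaler_eq0; apply/orP; left; apply/eqP; ring.
Qed.

Local Notation deltaCB := (mkder cb_var).

Lemma deltaCB_T i (j : 'I_(n i)) : deltaCB (genT j) = if j == c i then cb_value i else 0.
Proof. by rewrite /genT (mkder_piR chain_cb_relg) chain_var cb_varT. Qed.

Lemma deltaCB_S k : deltaCB (genS k) = 0.
Proof. by rewrite /genS (mkder_piR chain_cb_relg) chain_var cb_varS. Qed.

Definition cb_exp : 'X_{1..N} := (\sum_(k | beta k != 0%R) (expT k - U_(idxT (c k))))%MM.

Lemma cb_expT i (j : 'I_(n i)) :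
  cb_exp (idxT j) = if beta i != 0 then (expT i - U_(idxT (c i)))%MM (idxT j) else 0%N.
Proof.
have zero k : k != i -> (expT k - U_(idxT (c k)))%MM (idxT j) = 0%N.
  by move=> ki; rewrite mnmBE expT_T eq_sym (negPf ki).
rewrite mnm_sumE; case: ifP => bi.
  by rewrite (bigD1 i) //= big1 ?addn0 // => k /andP[_ /zero].
by rewrite big1 // => k bk; apply: zero; apply: contraFneq bi => <-.
Qed.

(** The factors of the divisor involve disjoint blocks of variables, and each divides M by [aM]. *)
Lemma cb_exp_le : (cb_exp <= M)%MM.
Proof.
apply/mnm_lepP; elim/var_ind => [i j|k].
  rewrite cb_expT; case: ifP => // bi; have [|/mnm_lepP] := @aM i (c i); last exact.
  by rewrite -beta_eq0.
by rewrite mnm_sumE big1 // => i _; rewrite mnmBE expT_S.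
Qed.

(** This is h; the scalar cancels the constants l_kc_k of the partial derivatives. *)
Definition cb_factor : R :=
  (\prod_(k | beta k != 0) (l (c k))%:R)^-1 *: mono (M - cb_exp).

Lemma graded_cb_factor : graded_piece (monK0 (M - cb_exp)%MM) cb_factor.
Proof.
exists ((\prod_(k | beta k != 0) (l (c k))%:R)^-1 *: 'X_[M - cb_exp]); first by rewrite piRZ.
by move=> mu /msuppZ_le; rewrite msuppX inE => /eqP->.
Qed.

(** For [beta i] nonzero, T_ic_i has exponent l_ic_i - 1 both in M and in the divisor, so it does
    not occur in h; all other variables are killed. *)
Lemma deltaCB_factor : deltaCB cb_factor = 0.
Proof.
rewrite /cb_factor (derZ _ _ (mkder_der chain_cb_relg)) (mkder_piR chain_cb_relg) chain_mono.
rewrite [X in _ *: X]big1 ?scaler0 //; elim/var_ind => [i j|k] _; last first.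
  by rewrite cb_varS mulr0 scaler0.
rewrite cb_varT; case: eqP => [->|_]; last by rewrite mulr0 scaler0.
have [b0|bi] := eqVneq (beta i) 0; first by rewrite /cb_value b0 scale0r mulr0 scaler0.
rewrite mnmBE cb_expT bi mnmBE mnm1E eqxx expT_T eqxx.
have [|_ <-] := @aM i (c i); first by rewrite -beta_eq0.
by rewrite subn1 subnn scale0r.
Qed.

Lemma cb_factor_value i : cb_factor * cb_value i = a (c i) *: mono (M - (expT i - U_(idxT (c i)))).
Proof.
have [b0|bi] := eqVneq (beta i) 0.
  move: (b0) => /eqP; rewrite beta_eq0 => /eqP->.
  by rewrite /cb_value b0 !scale0r mulr0.
rewrite /cb_value prod_dmonT /cb_factor -scalerAl !mul_scaleR -monoD !scalerA.
congr (_ *: mono _).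
  have P0 : \prod_(k | (beta k != 0) && (k != i)) (l (c k))%:R != 0 :> K.
    by apply/prodf_neq0 => k _; apply: natr_l_neq0.
  (* The constant for k = i is left over in the denominator and cancels the factor l_ic_i of
     [beta i]. *)
  rewrite [in X in X^-1](bigD1 i) //= [beta i]/beta.
  by field; rewrite P0 natr_l_neq0.
have : cb_exp = (expT i - U_(idxT (c i)) +
    \sum_(k | (beta k != 0%R) && (k != i)) (expT k - U_(idxT (c k))))%MM.
  by rewrite /cb_exp (bigD1 i).
move: cb_exp_le => /mnm_lepP le /mnmP E; apply/mnmP => v.
by have := E v; have := le v; rewrite !mnmDE !mnmBE; lia.
Qed.

Lemma der_cb f : delta f = cb_factor * deltaCB f.
Proof.
move: f; apply: (der_ext der (der_mulZ cb_factor (mkder_der chain_cb_relg))).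
elim/var_ind => [i j|k].
  rewrite -[piR _]/(genT j) dT deltaCB_T (coef_pivot j).
  case: eqP => [->|_]; first by rewrite cb_factor_value.
  by rewrite scale0r mulr0.
by rewrite -[piR _]/(genS k) dS deltaCB_S mulr0.
Qed.

Lemma card_pivot_gt1 : locally_nilpotent delta ->
  (#|[set i | (beta i != 0%R) && (1 < l (c i))%N]| <= 1)%N.
Proof.
move=> lnd; rewrite leqNgt; apply/negP => /card_gt1P [i [k []]].
rewrite !inE => /andP[bi li] /andP[bk lk] ik.
(* The exponent of T_k1c_k1 in M is one less than its l, hence positive, and dividing by T_i1^{l_i1}
   / T_i1c_i1 leaves block k1 untouched. *)
have div i1 k1 : i1 != k1 -> beta i1 != 0 -> beta k1 != 0 -> (1 < l (c k1))%N ->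
    exists w p, graded_piece w p /\ delta (genT (c i1)) = genT (c k1) * p.
  move=> ik1 bi1 bk1 lk1; set q := (M - (expT i1 - U_(idxT (c i1))))%MM.
  exists (monK0 (q - U_(idxT (c k1)))%MM), (a (c i1) *: mono (q - U_(idxT (c k1)))).
  split.
    exists (a (c i1) *: 'X_[q - U_(idxT (c k1))]); first by rewrite piRZ.
    by move=> mu /msuppZ_le; rewrite msuppX inE => /eqP->.
  rewrite dT mul_scaleR; congr (_ *: _); rewrite -[genT _]/(mono U_(idxT (c k1))) -monoD.
  rewrite addmC submK // lep1mP !mnmBE expT_T [k1 == i1]eq_sym (negPf ik1) sub0n subn0.
  have [|_ E] := @aM k1 (c k1); first by rewrite -beta_eq0.
  by rewrite -lt0n -ltnS E.
have [wp [p [hp Ep]]] := div _ _ ik bi bk lk.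
rewrite eq_sym in ik; have [wq [q [hq Eq]]] := div _ _ ik bk bi li.
have dT0 i1 : beta i1 != 0 -> delta (genT (c i1)) != 0.
  by move=> b1; rewrite dT scaler_eq0 negb_or mono_neq0 -beta_eq0 b1.
have := der_cross_div charK der deg_d lnd (graded_mono _) (graded_mono _) hp hq Ep Eq (dT0 _ bi).
by apply/eqP/dT0.
Qed.

Lemma deltaCB_is_CB : locally_nilpotent delta -> (exists i, beta i != 0) ->
  is_delta_CB c (\row_i beta i) deltaCB.
Proof.
move=> lnd [i1 bi1]; have der_CB := mkder_der chain_cb_relg; split.
- by apply: contraNneq bi1 => /rowP/(_ i1); rewrite !mxE => ->.
- have [b0 [b1 bE]] := beta_row; apply/submxP.
  exists (\row_(p < 2) if p == 0 then b0 else b1); apply/rowP => i.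
  rewrite !mxE bE big_ord_recl big_ord1 !mxE /=; congr (_ + _); rewrite mulrC //.
  by congr (_ * A _ _); apply: val_inj.
have [/existsP[i0 /eqP b0]|/existsPn nz] := boolP [exists i0, beta i0 == 0].
- have b0E i : (beta i == 0) = (i == i0).
    apply/eqP/eqP => [bi|->//]; apply/eqP/negPn/negP => ii0.
    by move: bi1; rewrite (beta_eq0_uniq ii0 bi b0) eqxx.
  apply: (@DeltaCase2 _ _ _ _ _ i0) => [i||]; first by rewrite mxE.
    apply: leq_trans (card_pivot_gt1 lnd); apply/subset_leq_card/subsetP => i.
    by rewrite !inE b0E.
  split=> // [i j|k]; last exact: deltaCB_S.
  rewrite deltaCB_T mxE /cb_value; case: ifP => // _; congr (_ *: piR _).
  by apply: eq_bigl => k; rewrite b0E andbC.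
apply: DeltaCase1 => [i||]; first by rewrite mxE.
  apply: leq_trans (card_pivot_gt1 lnd); apply/subset_leq_card/subsetP => i.
  by rewrite !inE nz.
split=> // [i j|k]; last exact: deltaCB_S.
rewrite deltaCB_T mxE /cb_value; case: ifP => // _; congr (_ *: piR _).
by apply: eq_bigl => k; rewrite nz.
Qed.

End Horizontal.

(** * Case distinction on whether delta kills all S_k *)

Theorem theorem4p3 (K : closedFieldType) (charK : [pchar K] =i pred0)
    (X : trinomial_data K) (delta : trinomial_ring X -> trinomial_ring X)
    (delta_der : derivation delta)
    (delta_nontrivial : exists f, delta f != 0)
    (delta_primitive : primitive delta)
    (delta_homog : homogeneous delta)
    (delta_lnd : locally_nilpotent delta) :
  (vertical_type delta ->
     (forall (i : 'I_(td_r X).+1) (j : 'I_(td_n i)), delta (genT j) = 0) /\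
     exists k0 : 'I_(td_m X),
       indep_of_S k0 (delta (genS k0)) /\
       forall k, k != k0 -> delta (genS k) = 0) /\
  (horizontal_type delta ->
     exists (c : forall i : 'I_(td_r X).+1, 'I_(td_n i))
            (beta : 'rV[K]_(td_r X).+1)
            (deltaCB : trinomial_ring X -> trinomial_ring X)
            (h : trinomial_ring X) (w : K0 X),
       [/\ is_delta_CB c beta deltaCB,
           graded_piece w h,
           deltaCB h = 0
         & forall f, delta f = h * deltaCB f]).
Proof.
case: delta_primitive => d deg_d prim.
have [/existsP[k0 dk0]|/existsPn dS0] := boolP [exists k, delta (genS k) != 0].
  have only := der_genS_only deg_d prim dk0.
  have vert := vertical_of_genS delta_der deg_d prim dk0.
  split=> [_|/(_ vert)//]; split=> [i j|]; first by apply: only; rewrite idxTS.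
  exists k0; split; first exact: (indep_of_S_der_genS deg_d prim).
  by move=> k kk0; apply: only; rewrite idxS_eq.
have dS k : delta (genS k) = 0 by apply/eqP/negPn/dS0.
have [i0 [j0 dT0]] : exists i (j : 'I_(td_n i)), delta (genT j) != 0.
  apply: contrapT => noT; case: delta_nontrivial => f /eqP; apply.
  have der_zero : derivation (fun=> 0 : trinomial_ring X).
    by split=> [s u v|u v]; rewrite ?scaler0 ?mul0r ?mulr0 addr0.
  apply: (der_ext delta_der der_zero); elim/var_ind => [i j|k]; last exact: dS.
  by apply: contrapT => /eqP dTij; apply: noT; exists i, j.
(* The nonzero image of T_i0j0 provides M. Its degree is expressed through block 0, since all
   T_i^{l_i} have the same degree. *)
have [mu /target_genT /[1!(monK0_expT i0 ord0)] degM] := der_var_target deg_d dT0.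
move: (mu + _)%MM degM => M degM.
have [a aP] := fin_all_exists (fun i => fin_all_exists (der_genT deg_d prim degM (i := i))).
have dT i j := (aP i j).1; have aM i j := (aP i j).2.
have beta0 : exists i, beta a i != 0.
  exists i0; rewrite beta_eq0 //; apply: contraNneq dT0 => ac0.
  by rewrite dT (coef_pivot aM j0) ac0 if_same scale0r.
(* Some [beta i] is nonzero, so delta cannot be vertical and (i) holds vacuously. *)
split=> [/(vertical_beta delta_der dT aM) vert|_].
  by case: beta0 => i; rewrite vert eqxx.
exists (pivot a), (\row_i beta a i), (mkder (cb_var a)), (cb_factor M a), (monK0 (M - cb_exp a)%MM).
split.
- exact: (deltaCB_is_CB charK delta_der deg_d dT aM delta_lnd beta0).
- exact: graded_cb_factor.
- exact: (deltaCB_factor charK delta_der dT aM).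
- exact: (der_cb charK delta_der dS dT aM).
Qed.
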